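(* Let $\mathbb{K}$ be a field of characteristic $0$ and let $(F(n))_{n=0}^{\infty}$ be a holonomic sequence over $\mathbb{K}$ of order $J>0$. Let $L=\sum_{i=0}^{J}a_i(n)\sigma^i\in \mathrm{ann}\,F(n)$, with $a_i(n)\in\mathbb{K}[n]$ and $a_0(n)a_J(n)\neq 0$. Suppose that $$\gcd(a_0(n),a_J(n+i))=1\quad\text{for all } i\in\mathbb{N}.$$ Then a polynomial $q(n)\in\mathbb{K}[n]$ satisfies $$q(n)F(n)=\Delta\left(\sum_{i=0}^{J-1}u_i(n)F(n+i)\right)$$ for some rational functions $u_0(n),u_1(n),\ldots,u_{J-1}(n)\in\mathbb{K}(n)$ if and only if $q(n)=L^{\ast}(p(n))$ for some polynomial $p(n)\in\mathbb{K}[n]$.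
   Context: $\mathbb{N}$ denotes the nonnegative integers. $\sigma$ is the shift operator, $\sigma F(n)=F(n+1)$, and $\Delta$ is the difference operator, $\Delta F(n)=F(n+1)-F(n)$. An operator $L=\sum_{i=0}^{J}a_i(n)\sigma^i\in\mathbb{K}[n][\sigma]$ acts on a sequence by $L(F(n))=\sum_{i=0}^{J}a_i(n)F(n+i)$. The annihilator of $F(n)$ is $\mathrm{ann}\,F(n)=\{L\in\mathbb{K}[n][\sigma] : L(F(n))=0\}$. The sequence $(F(n))_{n=0}^\infty$ is holonomic over $\mathbb{K}$ if there are polynomials $a_0(n),\ldots,a_J(n)\in\mathbb{K}[n]$ with $a_J(n)\ne 0$ such that $\sum_{i=0}^{J}a_i(n)F(n+i)=0$ (equivalently, $\mathrm{ann}\,F(n)\neq\{0\}$); $J$ is called the order of this recurrence, and the minimum order of all such recurrences is called the order of $F(n)$. The adjoint of $L=\sum_{i=0}^{J}a_i(n)\sigma^i$ is $L^{\ast}=\sum_{i=0}^{J}\sigma^{-i}a_i(n)$, so that $L^{\ast}(p(n))=\sum_{i=0}^{J}a_i(n-i)p(n-i)$. *)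

(* Defs.v *)
From HB Require Import structures.
From mathcomp Require Import all_boot all_order all_algebra.

Set Implicit Arguments.
Unset Strict Implicit.
Unset Printing Implicit Defensive.

Import GRing.Theory.
Local Open Scope ring_scope.
Local Open Scope quotient_scope.

Section Holonomic.
Variable K : fieldType.

(* The operator \sum_i a_i(n) sigma^i of K[n][sigma] is encoded by its
   coefficient sequence, as the L with L`_i = a_i; its order is (size L).-1.
   Only the additive structure is meant: the product of {poly {poly K}} is not
   the composition of operators, since sigma does not commute with n. *)
Definition shift_op := {poly {poly K}}.

Definition op_order (L : shift_op) : nat := (size L).-1.

Definition op_app (L : shift_op) (F : nat -> K) (n : nat) : K :=
  \sum_(i < size L) (L`_i).[n%:R] * F (n + i)%N.

Definition ann (F : nat -> K) (L : shift_op) : Prop :=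
  forall n : nat, op_app L F n = 0.

Definition holonomic_of_order (F : nat -> K) (J : nat) : Prop :=
  (exists L : shift_op, [/\ L != 0, ann F L & op_order L = J]) /\
  (forall L : shift_op, L != 0 -> ann F L -> (J <= op_order L)%N).

Definition adjoint_app (L : shift_op) (p : {poly K}) : {poly K} :=
  \sum_(i < size L)
    (L`_i \Po ('X - (i%:R)%:P)) * (p \Po ('X - (i%:R)%:P)).

Definition Delta (G : nat -> K) (n : nat) : K := G n.+1 - G n.

(* The representative of a class in {fraction {poly K}} need not be in lowest
   terms, so common factors are cancelled before evaluating. *)
Definition rf_num (u : {fraction {poly K}}) : {poly K} :=
  \n_(repr u) %/ gcdp \n_(repr u) \d_(repr u).

Definition rf_den (u : {fraction {poly K}}) : {poly K} :=
  \d_(repr u) %/ gcdp \n_(repr u) \d_(repr u).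

Definition rf_defined (u : {fraction {poly K}}) (x : K) : Prop :=
  (rf_den u).[x] != 0.

(* Meaningful only when rf_defined u x; the value at a pole is 0 by the
   convention 0^-1 = 0. *)
Definition rf_eval (u : {fraction {poly K}}) (x : K) : K :=
  (rf_num u).[x] / (rf_den u).[x].

Definition rf_comb (J : nat) (u : 'I_J -> {fraction {poly K}})
    (F : nat -> K) (n : nat) : K :=
  \sum_(i < J) rf_eval (u i) n%:R * F (n + i)%N.

(* q(n) F(n) = Delta (\sum_(i < J) u_i(n) F(n + i)), at every natural number n
   where both sides make sense, i.e. where no u_i has a pole at n or n + 1.
   In characteristic 0 this leaves out only finitely many n. *)
Definition telescopes (J : nat) (q : {poly K}) (F : nat -> K)
    (u : 'I_J -> {fraction {poly K}}) : Prop :=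
  forall n : nat,
    (forall i : 'I_J, rf_defined (u i) n%:R /\ rf_defined (u i) n.+1%:R) ->
    q.[n%:R] * F n = Delta (rf_comb u F) n.

Local Notation "x %:F" := (@FracField.tofrac _ x).

Lemma rf_repr (u : {fraction {poly K}}) :
  u = (\n_(repr u))%:F / (\d_(repr u))%:F.
Proof.
have dF0 : (\d_(repr u))%:F != 0 by rewrite tofrac_eq0 denom_ratioP.
apply: (mulIf dF0); rewrite mulfVK //.
rewrite -[u in u * _]reprK; move: (repr u) => x {u dF0}.
rewrite -[LHS]/(FracField.mul _ _) !piE /FracField.mulf.
rewrite !numden_Ratio ?oner_eq0 // mulr1; apply/eqP.
rewrite FracField.equivf_def !numden_Ratio ?oner_eq0 ?denom_ratioP //.
by rewrite mulr1 mulrC.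
Qed.

Lemma rf_den_neq0 (u : {fraction {poly K}}) : rf_den u != 0.
Proof. by rewrite dvdp_div_eq0 ?denom_ratioP // dvdp_gcdr. Qed.

Lemma rf_numden (u : {fraction {poly K}}) : u = (rf_num u)%:F / (rf_den u)%:F.
Proof.
have d0 := denom_ratioP (repr u).
set g := gcdp \n_(repr u) \d_(repr u).
have g0 : g%:F != 0 by rewrite tofrac_eq0 gcdp_eq0 negb_and d0 orbT.
have En : \n_(repr u) = rf_num u * g by rewrite divpK ?dvdp_gcdl.
have Ed : \d_(repr u) = rf_den u * g by rewrite divpK ?dvdp_gcdr.
by rewrite [LHS]rf_repr En Ed !tofracM invfM mulrACA divff // mulr1.
Qed.

Lemma rf_coprime (u : {fraction {poly K}}) : coprimep (rf_num u) (rf_den u).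
Proof. by rewrite coprimep_div_gcd // denom_ratioP orbT. Qed.

Lemma rf_evalE (a b : {poly K}) (x : K) : b.[x] != 0 ->
  rf_defined (a%:F / b%:F) x /\ rf_eval (a%:F / b%:F) x = a.[x] / b.[x].
Proof.
move=> bx; set u := _ / _.
have b0 : b != 0 by apply: contraNneq bx => ->; rewrite horner0.
have E : a * rf_den u = rf_num u * b.
  apply/eqP; rewrite -tofrac_eq !tofracM -eqr_div ?tofrac_eq0 ?rf_den_neq0 //.
  by rewrite -rf_numden.
have dvd : rf_den u %| b.
  by rewrite -(@Gauss_dvdpr _ _ (rf_num u)) -?E ?dvdp_mull // coprimep_sym rf_coprime.
have dx : rf_defined u x.
  by apply: contra bx => /eqP r; rewrite -(divpK dvd) hornerM r mulr0.
split=> //; apply/eqP; rewrite /rf_eval eqr_div // -!hornerM.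
by rewrite -E.
Qed.

End Holonomic.

(* Main.v *)
(* If q F = Delta (sum_i u_i F(n + i)), moving everything to one side gives an
   operator of order at most J annihilating F. By minimality of J it is a
   rational multiple p of L, and eliminating the u_i from the coefficient
   equations gives q = L^*(p). It remains to see that the reduced denominator Q
   of p is constant: in the identity q = sum_i a_i(n - i) p(n - i) the terms
   i = 0 and i = J show that Q divides a_0(n) prod_(1 <= i <= J) Q(n - i) and
   a_J(n) prod_(1 <= i <= J) Q(n + i). Iterating these, Q divides powers of
   prod_k a_0(n - k) and of prod_k a_J(n + k), which are coprime. *)

Require Import Defs.
From HB Require Import structures.
From mathcomp Require Import all_boot all_order all_algebra.
From mathcomp Require Import ring.

Set Implicit Arguments.
Unset Strict Implicit.
Unset Printing Implicit Defensive.

Import GRing.Theory.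
Local Open Scope ring_scope.

Local Notation shift c p := (p \Po ('X + c%:P)).

(** * Shifts of polynomials and coprimality *)

Section PolyShift.
Variable K : fieldType.
Implicit Types (p q a : {poly K}) (c d s x : K).

Lemma shiftD c d p : shift c (shift d p) = shift (c + d) p.
Proof.
rewrite -comp_polyA; congr (_ \Po _).
by rewrite comp_polyD comp_polyX comp_polyC polyCD addrA.
Qed.

Lemma shift0 p : shift 0 p = p.
Proof. by rewrite addr0 comp_polyXr. Qed.

Lemma horner_shift c p x : (shift c p).[x] = p.[x + c].
Proof. by rewrite horner_comp !hornerE. Qed.

Lemma shift_eq0 c p : (shift c p == 0) = (p == 0).
Proof. by rewrite comp_poly2_eq0 // size_XaddC. Qed.

(* The resultant of p(X + Y) and q(X) with respect to X is a nonzero polynomial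
   in Y, and it lies in the ideal they generate. *)
Lemma coprimep_shift_generic p q : p != 0 -> q != 0 ->
  exists2 r, r != 0 & forall c, r.[c] != 0 -> coprimep (shift c p) q.
Proof.
move=> p0 q0.
(* Constants are treated apart: the resultant argument needs both degrees positive. *)
have [sp|sp] := leqP (size p) 1.
  exists 1; rewrite ?oner_eq0 // => c _.
  move: p0; rewrite (size1_polyC sp) comp_polyC polyC_eq0 => p0.
  by rewrite -alg_polyC coprimepZl // coprime1p.
have [sq|sq] := leqP (size q) 1.
  exists 1; rewrite ?oner_eq0 // => c _.
  move: q0; rewrite (size1_polyC sq) polyC_eq0 => q0.
  by rewrite -[(q`_0)%:P]alg_polyC coprimepZr // coprimep1.
exists (sub_annihilant p q); first exact: sub_annihilant_neq0.
move=> c rc.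
rewrite -size_poly_XaY -(size_map_polyC q) in sp sq.
have [[u v] /= _] := resultant_in_ideal sp sq.
(* Setting Y to c gives a Bezout relation over K whose left side is the constant resultant at c. *)
move/(congr1 (map_poly (horner_eval c))).
rewrite rmorphD !rmorphM /= map_polyC /= map_comp_poly rmorphD /= map_polyX.
rewrite map_polyC /= -!map_poly_comp /=.
have E f : map_poly (horner_eval c \o polyC) f = f.
  by rewrite map_poly_id // => x _ /=; rewrite /horner_eval hornerC.
rewrite !E /horner_eval hornerX => Duv; apply/Bezout_eq1_coprimepP.
exists ((sub_annihilant p q).[c]^-1 *: map_poly (horner_eval c) u,
        (sub_annihilant p q).[c]^-1 *: map_poly (horner_eval c) v) => /=.
by rewrite -!scalerAl -scalerDr -Duv -mul_polyC -polyCM mulVf.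
Qed.

Hypothesis charK : [pchar K] =i pred0.

(** In characteristic 0 the multiples n s with n < [size p] are distinct, too many to be all roots
    of p. *)
Lemma exists_nonroot_natmul p s : p != 0 -> s != 0 ->
  exists n : nat, p.[n%:R * s] != 0.
Proof.
move=> p0 s0; set rs := [seq n%:R * s | n <- iota 0 (size p)].
have /allPn[_ /mapP[n _ ->] pn] : ~~ all (root p) rs.
  apply: contra p0 => rootp; apply/eqP/(roots_geq_poly_eq0 rootp).
    rewrite map_inj_uniq ?iota_uniq // => m n /(mulIf s0) /eqP.
    have wlg (i j : nat) : (i <= j)%N -> i%:R == j%:R :> K -> i = j.
      move=> le_ij /eqP E; apply/eqP; rewrite eqn_leq le_ij -subn_eq0 /=.
      by rewrite -(pcharf0P K).1 // natrB // E subrr.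
    have [le E|/ltnW le E] := leqP m n; first exact: wlg.
    by apply/esym/wlg; rewrite // eq_sym.
  by rewrite size_map size_iota.
by exists n.
Qed.

(* Substituting the hypothesis into itself pushes the shifts of Q away from Q;
   after finitely many steps they are coprime to Q and only the shifts of a
   remain. The exponents are irrelevant for coprimality. *)
Lemma dvdp_shift_prod a Q s J : s != 0 -> Q != 0 ->
  Q %| a * \prod_(i < J) shift (i.+1%:R * s) Q ->
  exists N e : nat, Q %| (\prod_(k < N) shift (k%:R * s) a) ^+ e.
Proof.
case: J => [|J] s0 Q0 Qdvd.
  exists 1, 1; rewrite expr1 big_ord1 mul0r shift0.
  by rewrite big_ord0 mulr1 in Qdvd.
pose R := \prod_(i < J.+1) shift (i%:R * s) Q.
have R0 : R != 0 by apply/prodf_neq0 => i _; rewrite shift_eq0.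
have RE c : shift c R = \prod_(i < J.+1) shift (c + i%:R * s) Q.
  by rewrite /R rmorph_prod; apply: eq_bigr => i _; rewrite /= shiftD.
have [r r0 cop] := coprimep_shift_generic R0 Q0.
have [N rN] := exists_nonroot_natmul r0 s0.
have {r r0 rN cop} copN := cop _ rN.
(* The factor i = 0 of the left side divides the shifted hypothesis; the other factors already occur
   in the next shift of [R], hence the square. *)
have step n : shift (n%:R * s) R %|
    shift (n%:R * s) a * shift (n.+1%:R * s) R ^+ 2.
  rewrite {1}RE big_ord_recl /= mul0r addr0 expr2 mulrA; apply: dvdp_mul.
    have /(dvdp_comp_poly ('X + (n%:R * s)%:P)) := Qdvd.
    rewrite comp_polyM RE rmorph_prod /=.
    under eq_bigr do rewrite /= shiftD -mulrDl -natrD addnS -addSn natrD mulrDl.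
    done.
  rewrite RE big_ord_recr /= dvdp_mulr //.
  under eq_bigr do rewrite /bump /= add1n -mulrDl -natrD addnS -addSn natrD mulrDl.
  exact: dvdpp.
have iter n : exists e : nat,
    Q %| ((\prod_(k < n) shift (k%:R * s) a) * shift (n%:R * s) R) ^+ e.
  elim: n => [|n [e IH]].
    exists 1; rewrite big_ord0 mul1r expr1 mul0r shift0 /R big_ord_recl.
    by rewrite mul0r shift0 dvdp_mulr.
  exists (2 * e)%N; apply: dvdp_trans IH _; rewrite exprM; apply: dvdp_exp2r.
  rewrite big_ord_recr /= exprMn expr2 -!mulrA dvdp_mul //.
  by do 2 apply: dvdp_mull; exact: step.
have [e] := iter N; rewrite exprMn Gauss_dvdpl; first by exists N, e.
by apply: coprimep_expr; rewrite coprimep_sym.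
Qed.

Lemma coprimep_prodl (I : finType) (f : I -> {poly K}) q :
  (forall i, coprimep (f i) q) -> coprimep (\prod_i f i) q.
Proof.
move=> cop; elim/big_ind: _ => //; first exact: coprime1p.
by move=> x y cx cy; rewrite coprimepMl cx.
Qed.

(** By [dvdp_shift_prod] with s = -1 and s = 1, Q divides a power of a product of a(n - i) and one
    of a product of b(n + j). These are coprime, as translates by -i of a(n) and b(n + i + j), so Q
    is coprime to itself. *)
Lemma size_eq1_dvdp_shift_prods a b Q J : Q != 0 ->
  (forall i : nat, coprimep a (shift i%:R b)) ->
  Q %| a * \prod_(i < J) shift (- i.+1%:R) Q ->
  Q %| b * \prod_(i < J) shift i.+1%:R Q ->
  size Q = 1.
Proof.
move=> Q0 cop Qa Qb.
have [||N [e Da]] := @dvdp_shift_prod a Q (-1) J _ Q0; rewrite ?oppr_eq0 ?oner_eq0 //.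
  by under eq_bigr do rewrite mulrN1.
have [||M [f Db]] := @dvdp_shift_prod b Q 1 J _ Q0; rewrite ?oner_eq0 //.
  by under eq_bigr do rewrite mulr1.
apply/eqP; rewrite -coprimepp; apply: (coprimep_dvdl Db).
apply: (coprimep_dvdr Da); apply/coprimep_expl/coprimep_expr.
apply: coprimep_prodl => i; rewrite coprimep_sym; apply: coprimep_prodl => j.
have := coprimep_comp_poly ('X + (- i%:R)%:P) (cop (i + j)%N).
by rewrite shiftD natrD addKr mulr1 mulrN1 coprimep_sym.
Qed.

End PolyShift.

Local Notation "x %:F" := (@FracField.tofrac _ x).

(** * Telescoping identities and annihilating operators *)

Section Telescoping.
Variable K : fieldType.
Implicit Types (L M : shift_op K) (F : nat -> K) (p q D P Q : {poly K}).

Lemma op_app_widen L F m n : (size L <= m)%N ->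
  op_app L F n = \sum_(i < m) (L`_i).[n%:R] * F (n + i)%N.
Proof.
move=> Lm; rewrite /op_app (big_ord_widen _ (fun i => (L`_i).[n%:R] * F (n + i)%N) Lm).
rewrite big_mkcond; apply: eq_bigr => i _.
by case: ltnP => // le; rewrite nth_default // horner0 mul0r.
Qed.

Lemma adjoint_app_widen L p m : (size L <= m)%N ->
  adjoint_app L p = \sum_(i < m) shift (- i%:R) (L`_i * p).
Proof.
move=> Lm; rewrite /adjoint_app.
pose f i := (L`_i \Po ('X - i%:R%:P)) * (p \Po ('X - i%:R%:P)).
rewrite (big_ord_widen _ f Lm) {}/f.
rewrite big_mkcond; apply: eq_bigr => i _; rewrite polyCN comp_polyM.
by case: ltnP => // le; rewrite nth_default // comp_poly0 mul0r.
Qed.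

(* Summation by parts: [(a_i p)(n - i) F(n) - (a_i p)(n) F(n + i)] is the
   difference of [- \sum_(j < i) (a_i p)(n - (i - j)) F(n + j)]. *)
Lemma adjoint_app_telescopes L F J p : (size L <= J.+1)%N -> ann F L ->
  exists u : 'I_J -> {fraction {poly K}}, telescopes (adjoint_app L p) F u.
Proof.
move=> LJ FL.
pose b i := L`_i * p.
(* The future u_j: the coefficient of F(n + j), collected over all i > j. *)
pose V j := - \sum_(j.+1 <= i < J.+1) shift (- (i - j)%:R) (b i).
have V_last : V J = 0 by rewrite /V big_geq ?oppr0.
have V_first : V 0%N = b 0%N - adjoint_app L p.
  rewrite (adjoint_app_widen _ LJ).
  rewrite -(big_mkord xpredT (fun i => shift (- i%:R) (b i))).
  rewrite big_ltn // oppr0 shift0 opprD addNKr /V.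
  by congr (- _); apply: eq_bigr => i _; rewrite subn0.
have V_shift j : (j < J)%N -> shift 1 (V j) = V j.+1 - b j.+1.
  move=> jJ; rewrite /V big_ltn ?ltnS // rmorphN rmorphD /= shiftD subSnn.
  rewrite subrr shift0 opprD addrC rmorph_sum; congr (- _ - _).
  apply: eq_big_nat => i /andP[ji _]; rewrite /= shiftD; congr (_ \Po ('X + _%:P)).
  by rewrite -(subnSK (ltnW ji)) -natr1; ring.
have V_step j (n : nat) : (j < J)%N ->
    (V j).[n.+1%:R] = (V j.+1).[n%:R] - (b j.+1).[n%:R].
  by move=> jJ; rewrite -hornerN -hornerD -V_shift // horner_shift natr1.
pose u (j : 'I_J) := (V j)%:F / 1%:F.
have uE (j : 'I_J) x : rf_eval (u j) x = (V j).[x].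
  by have [|_ ->] := @rf_evalE K (V j) 1 x; rewrite hornerC ?oner_eq0 // divr1.
exists u => n _; rewrite /Delta /rf_comb -sumrB.
transitivity (\sum_(j < J) (((V j.+1).[n%:R] * F (n + j.+1)%N
    - (V j).[n%:R] * F (n + j)%N) - (b j.+1).[n%:R] * F (n + j.+1)%N)); last first.
  by apply: eq_bigr => j _; rewrite !uE V_step // addnS addSn; ring.
rewrite sumrB -(big_mkord xpredT (fun j => (V j.+1).[n%:R] * F (n + j.+1)%N
    - (V j).[n%:R] * F (n + j)%N)).
rewrite (telescope_sumr (fun j => (V j).[n%:R] * F (n + j)%N)) //.
rewrite V_last V_first horner0 addn0 !hornerE.
(* Besides L^*(p) F, the telescoped sum leaves only -p(n) L(F(n)), which vanishes. *)
have : \sum_(i < J.+1) (b i).[n%:R] * F (n + i)%N = 0.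
  transitivity (p.[n%:R] * op_app L F n); last by rewrite FL mulr0.
  rewrite (op_app_widen _ _ LJ) mulr_sumr; apply: eq_bigr => i _.
  by rewrite hornerM; ring.
rewrite big_ord_recl /= addn0 => /eqP; rewrite addrC addr_eq0 => /eqP ->.
by rewrite hornerM; ring.
Qed.

(* The coefficient of F(n + i) in
   D(n) D(n + 1) (q(n) F(n) - Delta (\sum_(i < J) U_i(n) / D(n) F(n + i))),
   with the convention U_J = 0. *)
Definition comb_coef q (U : nat -> {poly K}) D i :=
  if i is k.+1 then shift 1 D * U i - D * shift 1 (U k)
  else D * shift 1 D * q + shift 1 D * U 0%N.

Lemma telescopes_clear_den F J q (u : 'I_J -> {fraction {poly K}}) :
  telescopes q F u ->
  exists D U, [/\ D != 0, U J = 0 & forall n : nat,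
    \sum_(i < J.+1) (D * shift 1 D * comb_coef q U D i).[n%:R] * F (n + i)%N = 0].
Proof.
move=> tel.
pose D := \prod_(i < J) rf_den (u i).
(* Numerators over the common denominator [D], extended by 0 so that [U J] is defined. *)
pose U k :=
  if insub k is Some i then rf_num (u i) * \prod_(j < J | j != i) rf_den (u j)
  else 0.
have UJ : U J = 0 by rewrite /U insubF ?ltnn.
have D0 : D != 0 by apply/prodf_neq0 => i _; exact: rf_den_neq0.
exists D, U; split=> // n; set x : K := n%:R.
under eq_bigr do rewrite hornerM -mulrA.
rewrite -mulr_sumr; have [->|] := eqVneq (D * shift 1 D).[x] 0; first by rewrite mul0r.
rewrite hornerM horner_shift mulf_eq0 negb_or => /andP[Dx Dx1].
have defE (i : 'I_J) y : D.[y] != 0 ->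
    rf_defined (u i) y /\ rf_eval (u i) y = (U i).[y] / D.[y].
  rewrite /D (bigD1 i) //= hornerM mulf_eq0 negb_or => /andP[d0 r0].
  by split=> //; rewrite /U valK hornerM invfM mulrACA divff // mulr1.
have xS : n.+1%:R = x + 1 :> K by rewrite -natr1.
have := tel n _; rewrite xS -/x => /(_ (fun i => conj (defE i x Dx).1 (defE i _ Dx1).1)).
rewrite /Delta /rf_comb xS -/x.
under eq_bigr do rewrite (defE _ _ Dx1).2 mulrAC.
under [X in _ - X]eq_bigr do rewrite (defE _ _ Dx).2 mulrAC.
rewrite -!mulr_suml => E; apply/eqP; rewrite mulf_eq0; apply/orP; right; apply/eqP.
have Ub : \sum_(i < J) (U i).[x] * F (n + i)%N =
    (U 0%N).[x] * F n + \sum_(i < J) (U i.+1).[x] * F (n + i.+1)%N.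
  transitivity (\sum_(i < J.+1) (U i).[x] * F (n + i)%N).
    by rewrite big_ord_recr /= UJ horner0 mul0r addr0.
  by rewrite big_ord_recl /= addn0.
rewrite big_ord_recl /= addn0.
transitivity (D.[x] * D.[x + 1] * (q.[x] * F n)
   + D.[x + 1] * \sum_(i < J) (U i).[x] * F (n + i)%N
   - D.[x] * \sum_(i < J) (U i).[x + 1] * F (n.+1 + i)%N).
  rewrite Ub mulrDr !mulr_sumr hornerD !hornerM !horner_shift -/x.
  under eq_bigr => i _ do
    rewrite /bump /= add1n hornerD hornerN !hornerM !horner_shift mulrBl -!mulrA.
  rewrite sumrB; under [X in _ = _ - X]eq_bigr do rewrite addSnnS.
  by ring.
by rewrite E; field; rewrite Dx Dx1.
Qed.

(** Cancelling the leading terms of L and M leaves an annihilating operator of size at most J, which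
    is zero by minimality. *)
Lemma ann_proportional F J L M : holonomic_of_order F J -> (0 < J)%N ->
  (size L <= J.+1)%N -> ann F L -> (size M <= J.+1)%N -> ann F M ->
  forall i, L`_J * M`_i = M`_J * L`_i.
Proof.
move=> [_ minJ] J0 sL FL sM FM i.
pose R : shift_op K := L`_J *: M - M`_J *: L.
have RE k : R`_k = L`_J * M`_k - M`_J * L`_k by rewrite coefB !coefZ.
have sR : (size R <= J)%N.
  apply/leq_sizeP => k; rewrite RE leq_eqVlt => /orP[/eqP <-|Jk].
    by rewrite mulrC subrr.
  rewrite (nth_default _ (leq_trans sM Jk)) (nth_default _ (leq_trans sL Jk)).
  by rewrite !mulr0 subrr.
have FR : ann F R.
  move=> n; rewrite (op_app_widen _ _ (leqW sR)).
  transitivity ((L`_J).[n%:R] * op_app M F n - (M`_J).[n%:R] * op_app L F n).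
    rewrite (op_app_widen _ _ sL) (op_app_widen _ _ sM) !mulr_sumr -sumrB.
    by apply: eq_bigr => k _; rewrite RE hornerD hornerN !hornerM; ring.
  by rewrite FM FL !mulr0 subrr.
have [R0|R0] := eqVneq R 0.
  by apply/eqP; rewrite -subr_eq0 -RE R0 coef0.
have := minJ R R0 FR; rewrite /op_order leqNgt.
by rewrite prednK ?size_poly_gt0 // sR.
Qed.

(** After multiplication by all the Q j, every term except the i-th visibly contains the factor Q
    i. *)
Lemma dvdp_sum_frac n (N Q : 'I_n -> {poly K}) q (i : 'I_n) :
  (forall j, Q j != 0) -> \sum_j (N j)%:F / (Q j)%:F = q%:F ->
  Q i %| N i * \prod_(j < n | j != i) Q j.
Proof.
move=> Q0 E.
have QF j : (Q j)%:F != 0 by rewrite tofrac_eq0.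
apply/dvdpP; exists (q * \prod_(j | j != i) Q j
  - \sum_(k | k != i) N k * \prod_(j | (j != i) && (j != k)) Q j).
apply/eqP; rewrite -tofrac_eq; apply/eqP.
rewrite (bigD1 i) //= in E.
rewrite !tofracM tofracB tofracM -E rmorph_sum /=.
rewrite [_ * (\prod_(j < n | _) _)%:F in RHS]mulrDl mulr_suml.
have -> : \sum_(k | k != i) (N k)%:F / (Q k)%:F * (\prod_(j | j != i) Q j)%:F =
   \sum_(k | k != i) (N k * \prod_(j | (j != i) && (j != k)) Q j)%:F.
  apply: eq_bigr => k ki; rewrite (bigD1 k) //= !tofracM mulrA.
  by rewrite divfK.
by rewrite addrK mulrAC divfK.
Qed.

(** This is L^*(P/Q) = q. Dividing the i-th equation by Q(n) D(n) D(n + 1) and shifting by -i makes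
    the U-terms telescope. *)
Lemma adjoint_frac L J q U D P Q : D != 0 -> Q != 0 -> U J = 0 ->
  (forall i, (i <= J)%N -> Q * comb_coef q U D i = P * L`_i * (D * shift 1 D)) ->
  \sum_(i < J.+1) (shift (- i%:R) (L`_i * P))%:F / (shift (- i%:R) Q)%:F = q%:F.
Proof.
move=> D0 Q0 UJ E.
have sF c p : p != 0 -> (shift c p)%:F != 0.
  by move=> p0; rewrite tofrac_eq0 shift_eq0.
pose w i := (shift (- i%:R) (U i))%:F / (shift (- i%:R) D)%:F.
have T i : (i <= J)%N -> (shift (- i%:R) (L`_i * P))%:F / (shift (- i%:R) Q)%:F =
   if i is k.+1 then w k.+1 - w k else q%:F + w 0%N.
  move=> iJ; have := congr1 (fun p => (shift (- i%:R) p)%:F) (E i iJ).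
  rewrite [L`_i * P]mulrC.
  move=> Ei; transitivity ((shift (- i%:R) (comb_coef q U D i))%:F /
      (shift (- i%:R) (D * shift 1 D))%:F).
    apply/eqP; rewrite eqr_div ?sF ?mulf_neq0 ?shift_eq0 //.
    by rewrite -!tofracM -!comp_polyM -Ei mulrC.
  have f0 (R : fieldType) (a b c d : R) : a != 0 -> b != 0 ->
    (a * b * c + b * d) / (a * b) = c + d / a by move=> a0 b0; field; rewrite a0 b0.
  have f1 (R : fieldType) (a b c d : R) : a != 0 -> b != 0 ->
    (b * c - a * d) / (a * b) = c / a - d / b by move=> a0 b0; field; rewrite a0 b0.
  rewrite /w /comb_coef.
  case: i {iJ Ei} => [|k] /=.
    rewrite oppr0 !shift0 tofracD !tofracM.
    by apply: f0; rewrite ?sF // tofrac_eq0.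
  have sk p : shift (- k.+1%:R) (shift 1 p) = shift (- k%:R) p.
    by rewrite shiftD -natr1 opprD addrNK.
  rewrite comp_polyB !comp_polyM !sk tofracB !tofracM.
  by apply: f1; rewrite sF.
rewrite big_ord_recl T //= (eq_bigr (fun k : 'I_J => w k.+1 - w k)); last first.
  by move=> k _; rewrite T.
rewrite -(big_mkord xpredT (fun k => w k.+1 - w k)) telescope_sumr // addrC addrA.
by rewrite addrAC subrK [w J]/w UJ comp_poly0 tofrac0 mul0r add0r.
Qed.

End Telescoping.

Theorem theorem4 (K : fieldType) (charK : [pchar K] =i pred0)
    (F : nat -> K) (J : nat) (J_gt0 : (0 < J)%N)
    (F_holonomic : holonomic_of_order F J)
    (L : shift_op K) (L_size : (size L <= J.+1)%N) (L_ann : ann F L)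
    (L_ends : L`_0 * L`_J != 0)
    (L_coprime : forall i : nat,
       coprimep L`_0 (L`_J \Po ('X + (i%:R)%:P)))
    (q : {poly K}) :
  (exists u : 'I_J -> {fraction {poly K}}, telescopes q F u) <->
  (exists p : {poly K}, q = adjoint_app L p).
Proof.
split=> [[u tel]|[p ->]]; last exact: adjoint_app_telescopes.
have LJ0 : L`_J != 0 by apply: contraNneq L_ends => ->; rewrite mulr0.
have [D [U [D0 UJ FM]]] := telescopes_clear_den tel.
set E := D * shift 1 D in FM; set m := comb_coef q U D in FM.
have E0 : E != 0 by rewrite mulf_neq0 ?shift_eq0.
pose M : shift_op K := \poly_(i < J.+1) (E * m i).
have M_ann : ann F M.
  move=> n; rewrite (op_app_widen F n (size_poly _ _)) -[RHS](FM n).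
  by apply: eq_bigr => i _; rewrite coef_poly ltn_ord.
have LM i : (i <= J)%N -> L`_J * m i = m J * L`_i.
  move=> iJ; apply: (mulfI E0).
  have := ann_proportional F_holonomic J_gt0 L_size L_ann (size_poly _ _) M_ann i.
  by rewrite !coef_poly ltnS iJ ltnSn => Mi; rewrite mulrCA Mi -mulrA.
(* The rational multiplier of L is [m J] / [Q0]; P / Q is its reduced form. *)
pose Q0 := L`_J * E; pose g := gcdp (m J) Q0.
have Q0_neq0 : Q0 != 0 by rewrite mulf_neq0.
have g0 : g != 0 by rewrite gcdp_eq0 negb_and Q0_neq0 orbT.
pose P := m J %/ g; pose Q := Q0 %/ g.
have PE : m J = P * g by rewrite divpK ?dvdp_gcdl.
have QE : Q0 = Q * g by rewrite divpK ?dvdp_gcdr.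
have copQP : coprimep Q P by rewrite coprimep_sym coprimep_div_gcd // Q0_neq0 orbT.
have Qneq0 : Q != 0 by apply: contraNneq Q0_neq0 => Q_eq0; rewrite QE Q_eq0 mul0r.
have Qm i : (i <= J)%N -> Q * m i = P * L`_i * E.
  move=> iJ; apply: (mulIf g0).
  transitivity (L`_J * m i * E); first by rewrite mulrAC -QE /Q0 mulrAC.
  by rewrite LM // PE; ring.
have sum_q := adjoint_frac D0 Qneq0 UJ Qm.
have Qs_neq0 (j : 'I_J.+1) : shift (- j%:R) Q != 0 by rewrite shift_eq0.
(* From the summand i = 0; P drops out by coprimality. *)
have Q_first : Q %| L`_0 * \prod_(i < J) shift (- i.+1%:R) Q.
  have := dvdp_sum_frac ord0 Qs_neq0 sum_q.
  rewrite big_mkcond big_ord_recl /= mul1r oppr0 !shift0 mulrAC.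
  by rewrite Gauss_dvdpl.
(* The summand i = J, shifted by J so that its denominator becomes Q; reversing the index turns the
   other shifts into 1, ..., J. *)
have Q_last : Q %| L`_J * \prod_(i < J) shift i.+1%:R Q.
  have := dvdp_comp_poly ('X + (J%:R)%:P) (dvdp_sum_frac ord_max Qs_neq0 sum_q).
  rewrite big_mkcond big_ord_recr /= eqxx mulr1.
  rewrite comp_polyM rmorph_prod !shiftD subrr !shift0.
  rewrite mulrAC Gauss_dvdpl // (reindex_inj rev_ord_inj) /=.
  congr (_ %| _ * _); apply: eq_bigr => i _.
  rewrite ifT; last by rewrite -val_eqE /= ltn_eqF // ltn_subrL.
  rewrite /= shiftD; congr (_ \Po ('X + _%:P)).
  by rewrite -natrB ?leq_subr // subKn.
have sQ := size_eq1_dvdp_shift_prods charK Qneq0 L_coprime Q_first Q_last.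
have [c c0 Qc] : exists2 c, c != 0 & Q = c%:P.
  by apply/size_poly1P; rewrite sQ.
exists (c^-1 *: P); rewrite (adjoint_app_widen _ L_size).
apply/eqP; rewrite -tofrac_eq -sum_q rmorph_sum; apply/eqP/eq_bigr => i _ /=.
have cF : (c%:P)%:F != 0 by rewrite tofrac_eq0 polyC_eq0.
rewrite Qc comp_polyC; apply: (mulIf cF); rewrite divfK // -tofracM.
by rewrite -scalerAr comp_polyZ [_ * c%:P]mulrC mul_polyC scalerA divff // scale1r.
Qed.
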